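(* Let $m\in\mathbb{N}$ and $x\in\mathbb{R}^{m+1}$. Then the Riesz potential $p(x)=|1-x|^{-(m-1)}$ admits the following expansion in series: $$p(x)=\sum_{k=0}^\infty\frac{(m-1)_k}{k!}\,\mathcal{P}_k^m(x),\qquad |x|<1,$$ where $\mathcal{P}_k^m(x)=\sum_{s=0}^k\binom ks\frac{\left(\frac{m-1}2\right)_{k-s}\left(\frac{m-1}2\right)_s}{(m-1)_k}x^{k-s}\bar{x}^s$.
   Context: Points of $\mathbb{R}^{m+1}$ are identified with paravectors $x=x_0+\underline{x}$, $\underline{x}=\sum_{j=1}^mx_je_j$, in the real Clifford algebra $\mathbb{R}_m$ generated by $e_1,\dots,e_m$ with $e_je_\ell+e_\ell e_j=-2\delta_{j\ell}$; $\bar{x}=x_0-\underline{x}$ and $|x|$ is the Euclidean norm. $(a)_s=\Gamma(a+s)/\Gamma(a)$ is the Pochhammer symbol. *)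

(* Defs.v *)
From HB Require Import structures.
From mathcomp Require Import all_boot all_order all_algebra.
From mathcomp Require Import all_classical all_reals all_analysis.

Set Implicit Arguments.
Unset Strict Implicit.
Unset Printing Implicit Defensive.

Import Order.TTheory GRing.Theory Num.Theory.
Import numFieldNormedType.Exports.

Local Open Scope ring_scope.

(* The Clifford algebra R_m on the generators e_0, ..., e_(m-1) (indexed from
   0), as the free R-module on the products e_A, A a set of indices listed in
   increasing order. Being a space of row vectors it inherits their
   finite-dimensional topology when R is a realType. *)
Definition clifford (R : Type) (m : nat) : Type := 'rV[R]_#|{set 'I_m}|.

Section CliffordAlgebra.
Variables (R : comNzRingType) (m : nat).
Implicit Types (A B C : {set 'I_m}) (a b c : clifford R m).

HB.instance Definition _ := GRing.Lmodule.copy (clifford R m)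
  'rV[R]_#|{set 'I_m}|.

Definition cl_coord a A : R := (a : 'rV_#|{set 'I_m}|) ord0 (enum_rank A).

Definition cl_basis A : clifford R m := delta_mx ord0 (enum_rank A).

Definition sym_diff A B : {set 'I_m} := [set i | (i \in A) (+) (i \in B)]%SET.

(* e_A e_B = cl_sign A B *: e_(A symdiff B): sorting the product costs a factor
   -1 for each pair i in A, j in B with j < i (anticommutation), and each
   common index contributes e_i ^ 2 = -1. *)
Definition cl_sign A B : R :=
  \prod_(i in A) \prod_(j in B | (j <= i)%N) -1.

Definition cl_mul a b : clifford R m :=
  \sum_A \sum_B
    (cl_coord a A * cl_coord b B * cl_sign A B) *: cl_basis (sym_diff A B).

Definition cl_one : clifford R m := cl_basis finset.set0.

Lemma cl_coordD a b A : cl_coord (a + b) A = cl_coord a A + cl_coord b A.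
Proof. by rewrite /cl_coord mxE. Qed.

Lemma cl_coordZ k a A : cl_coord (k *: a) A = k * cl_coord a A.
Proof. by rewrite /cl_coord mxE. Qed.

Lemma cl_coord_basis A B : cl_coord (cl_basis A) B = (A == B)%:R.
Proof.
by rewrite /cl_coord mxE eqxx /= (inj_eq enum_rank_inj) eq_sym.
Qed.

Lemma cl_expand a : a = \sum_A cl_coord a A *: cl_basis A.
Proof.
rewrite [LHS](row_sum_delta (a : 'rV_#|{set 'I_m}|)).
rewrite (reindex_onto enum_rank enum_val) /= => [|i _]; last exact: enum_valK.
by apply: eq_bigl => A; rewrite enum_rankK eqxx.
Qed.

Lemma cl_mulDl : left_distributive cl_mul +%R.
Proof.
move=> a b c; rewrite /cl_mul -big_split; apply: eq_bigr => A _.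
rewrite -big_split; apply: eq_bigr => B _.
by rewrite cl_coordD !mulrDl scalerDl.
Qed.

Lemma cl_mulDr : right_distributive cl_mul +%R.
Proof.
move=> a b c; rewrite /cl_mul -big_split; apply: eq_bigr => A _.
rewrite -big_split; apply: eq_bigr => B _.
by rewrite cl_coordD mulrDr mulrDl scalerDl.
Qed.

Lemma cl_mulZl k a b : k *: cl_mul a b = cl_mul (k *: a) b.
Proof.
rewrite /cl_mul scaler_sumr; apply: eq_bigr => A _.
rewrite scaler_sumr; apply: eq_bigr => B _.
by rewrite cl_coordZ scalerA !mulrA.
Qed.

Lemma cl_mulZr k a b : k *: cl_mul a b = cl_mul a (k *: b).
Proof.
rewrite /cl_mul scaler_sumr; apply: eq_bigr => A _.
rewrite scaler_sumr; apply: eq_bigr => B _.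
by rewrite cl_coordZ scalerA !mulrA [k * _]mulrC.
Qed.

Lemma cl_mul0l b : cl_mul 0 b = 0.
Proof. by rewrite -(scale0r b) -cl_mulZl !scale0r. Qed.

Lemma cl_mul0r a : cl_mul a 0 = 0.
Proof. by rewrite -(scale0r a) -cl_mulZr !scale0r. Qed.

Lemma cl_ind (P : clifford R m -> Prop) :
  P 0 -> (forall a b, P a -> P b -> P (a + b)) ->
  (forall k A, P (k *: cl_basis A)) -> forall a, P a.
Proof. by move=> P0 PD PZ a; rewrite [a]cl_expand; apply: big_ind. Qed.

Lemma cl_mul_basis A B :
  cl_mul (cl_basis A) (cl_basis B) = cl_sign A B *: cl_basis (sym_diff A B).
Proof.
rewrite /cl_mul (bigD1 A) //= (bigD1 B) //= !cl_coord_basis !eqxx !mul1r.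
rewrite [X in _ + X + _]big1 ?[X in _ + X]big1 ?addr0 // => C nC.
  apply: big1 => D _.
  by rewrite !cl_coord_basis eq_sym (negPf nC) !mul0r scale0r.
by rewrite !cl_coord_basis [B == C]eq_sym (negPf nC) mulr0 mul0r scale0r.
Qed.

Lemma sym_diffA : associative sym_diff.
Proof. by move=> A B C; apply/setP=> i; rewrite !inE addbA. Qed.

Lemma sym_diff0l : left_id finset.set0 sym_diff.
Proof. by move=> A; apply/setP=> i; rewrite !inE. Qed.

Lemma sym_diff0r : right_id finset.set0 sym_diff.
Proof. by move=> A; apply/setP=> i; rewrite !inE addbF. Qed.

Let prod_sym_diff (P : pred 'I_m) (f : 'I_m -> R) A B :
  (forall i, f i * f i = 1) ->
  \prod_(i in sym_diff A B | P i) f i =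
  (\prod_(i in A | P i) f i) * \prod_(i in B | P i) f i.
Proof.
move=> f2; rewrite big_mkcond [X in _ = X * _]big_mkcond.
rewrite [X in _ = _ * X]big_mkcond -big_split /=; apply: eq_bigr => i _.
rewrite !inE; case: (i \in A); case: (i \in B); case: (P i) => //=;
  by rewrite ?f2 ?mulr1 ?mul1r.
Qed.

Lemma cl_sign_diffr A B C :
  cl_sign A (sym_diff B C) = cl_sign A B * cl_sign A C.
Proof.
rewrite /cl_sign -big_split; apply: eq_bigr => i _ /=.
by apply: prod_sym_diff => _; rewrite mulrNN mulr1.
Qed.

Lemma cl_sign_diffl A B C :
  cl_sign (sym_diff A B) C = cl_sign A C * cl_sign B C.
Proof.
have := @prod_sym_diff predT (fun i => \prod_(j in C | (j <= i)%N) -1) A B.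
rewrite /cl_sign; under eq_bigl do rewrite andbT.
under [in X in X * _]eq_bigl do rewrite andbT.
under [in X in _ * X]eq_bigl do rewrite andbT.
by apply=> i; rewrite -big_split big1 //= => _ _; rewrite mulrNN mulr1.
Qed.

Lemma cl_sign0l A : cl_sign finset.set0 A = 1.
Proof. by rewrite /cl_sign big_set0. Qed.

Lemma cl_sign0r A : cl_sign A finset.set0 = 1.
Proof. by rewrite /cl_sign big1 // => i _; apply: big1 => j; rewrite inE. Qed.

Lemma cl_mulA : associative cl_mul.
Proof.
move=> a b c.
elim/cl_ind: a => [|a a' IHa IHa'|k A]; first by rewrite !cl_mul0l.
  by rewrite !cl_mulDl IHa IHa'.
rewrite -!cl_mulZl; congr (_ *: _); move: b c.
elim/cl_ind => [c|b b' IHb IHb' c|l B c].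
- by rewrite cl_mul0r !cl_mul0l cl_mul0r.
- by rewrite cl_mulDl !cl_mulDr cl_mulDl IHb IHb'.
rewrite -cl_mulZl -!cl_mulZr -cl_mulZl; congr (_ *: _); move: c.
elim/cl_ind => [|c c' IHc IHc'|n C]; first by rewrite !cl_mul0r.
  by rewrite !cl_mulDr IHc IHc'.
rewrite -!cl_mulZr !cl_mul_basis -cl_mulZr -cl_mulZl !cl_mul_basis sym_diffA.
rewrite !scalerA cl_sign_diffl cl_sign_diffr -!mulrA.
by rewrite [cl_sign B C * _]mulrC -mulrA.
Qed.

Lemma cl_mul1l : left_id cl_one cl_mul.
Proof.
elim/cl_ind => [|a b IHa IHb|k A]; first exact: cl_mul0r.
  by rewrite cl_mulDr IHa IHb.
by rewrite -cl_mulZr cl_mul_basis cl_sign0l sym_diff0l scale1r.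
Qed.

Lemma cl_mul1r : right_id cl_one cl_mul.
Proof.
elim/cl_ind => [|a b IHa IHb|k A]; first exact: cl_mul0l.
  by rewrite cl_mulDl IHa IHb.
by rewrite -cl_mulZl cl_mul_basis cl_sign0r sym_diff0r scale1r.
Qed.

Lemma cl_one_neq0 : cl_one != 0.
Proof.
apply/eqP => /(congr1 (cl_coord^~ finset.set0)) /eqP.
by rewrite cl_coord_basis eqxx /cl_coord mxE oner_eq0.
Qed.

HB.instance Definition _ := GRing.Zmodule_isNzRing.Build (clifford R m)
  cl_mulA cl_mul1l cl_mul1r cl_mulDl cl_mulDr cl_one_neq0.

HB.instance Definition _ :=
  GRing.Lmodule_isLalgebra.Build R (clifford R m) cl_mulZl.

HB.instance Definition _ :=
  GRing.Lalgebra_isAlgebra.Build R (clifford R m) cl_mulZr.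

Lemma cl_mulE a b : a * b = cl_mul a b. Proof. by []. Qed.

Definition cl_gen (j : 'I_m) : clifford R m := cl_basis [set j]%SET.

Lemma cl_gen_rel (j l : 'I_m) :
  cl_gen j * cl_gen l + cl_gen l * cl_gen j = (-2 * (j == l)%:R)%:A.
Proof.
have sg (i k : 'I_m) : cl_sign [set i]%SET [set k]%SET
    = if (k <= i)%N then -1 else 1.
  by rewrite /cl_sign big_set1 big_mkcondr /= big_set1.
rewrite !cl_mulE !cl_mul_basis !sg.
have [->|njl] := eqVneq j l.
  have -> : sym_diff [set l]%SET [set l]%SET = finset.set0.
    by apply/setP=> i; rewrite !inE addbb.
  by rewrite leqnn -scalerDl -opprD mulr1.
have -> : sym_diff [set l]%SET [set j]%SET = sym_diff [set j]%SET [set l]%SET.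
  by apply/setP=> i; rewrite !inE addbC.
rewrite -scalerDl mulr0 scale0r; have := njl.
by rewrite -val_eqE /=; case: ltngtP => //= _ _; rewrite ?subrr ?addNr scale0r.
Qed.

(* Hence e_A is the product of the e_j, j in A, in increasing order. *)
Lemma cl_basis_gen A (j : 'I_m) : (forall i, i \in A -> (i < j)%N) ->
  cl_basis A * cl_gen j = cl_basis (j |: A)%SET.
Proof.
move=> ltAj; rewrite cl_mulE cl_mul_basis.
have -> : cl_sign A [set j]%SET = 1.
  rewrite /cl_sign big1 // => i Ai.
  by rewrite big_mkcondr /= big_set1 leqNgt ltAj.
rewrite scale1r; congr cl_basis; apply/setP => i; rewrite !inE.
case: eqVneq => [->|_]; last by rewrite addbF.
by rewrite addbT; case Aj: (j \in A) => //; have := ltAj _ Aj; rewrite ltnn.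
Qed.

End CliffordAlgebra.

HB.instance Definition _ (R : realType) (m : nat) :=
  NormedModule.copy (clifford R m) 'rV[R]_#|{set 'I_m}|.

Section Paravectors.
Variables (R : realType) (m : nat).
Implicit Types x : 'rV[R]_m.+1.

(* The library norm `|x| on row vectors is the sup norm. *)
Definition enorm x : R := Num.sqrt (\sum_i x ord0 i ^+ 2).

Definition vecpart x : clifford R m :=
  \sum_(j < m) x ord0 (lift ord0 j) *: cl_gen R j.

Definition paravec x : clifford R m := (x ord0 ord0)%:A + vecpart x.

Definition paraconj x : clifford R m := (x ord0 ord0)%:A - vecpart x.

Definition one_pt : 'rV[R]_m.+1 := delta_mx ord0 ord0.

Lemma paravec_one_pt : paravec one_pt = 1.
Proof.
rewrite /paravec /vecpart big1 ?addr0 => [|j _]; first by rewrite mxE scale1r.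
by rewrite mxE /= scale0r.
Qed.

End Paravectors.

Arguments one_pt {R m}.

Section Series.
Variable R : realType.

Definition Gamma (a : R) : R :=
  \int[lebesgue_measure]_(t in `]0%R, +oo[) (t `^ (a - 1) * expR (- t)).

(* Euler's integral gives Gamma only for a > 0. At its pole a = 0, reached when
   m = 1, the quotient Gamma (a + s) / Gamma a is read as its limit, which is 1
   if s = 0 and 0 otherwise. *)
Definition pochhammer (a : R) (s : nat) : R :=
  if a == 0 then (s == 0%N)%:R else Gamma (a + s%:R) / Gamma a.

(* For m = 1 and k > 0 the denominator vanishes and the library's x / 0 = 0
   makes rieszP equal to 0; in the expansion this value is multiplied by
   pochhammer 0 k = 0. *)
Definition rieszP (m k : nat) (x : 'rV[R]_m.+1) : clifford R m :=
  \sum_(s < k.+1)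
    ('C(k, s)%:R * (pochhammer ((m%:R - 1) / 2) (k - s)
                    * pochhammer ((m%:R - 1) / 2) s
                    / pochhammer (m%:R - 1) k))
    *: (paravec x ^+ (k - s) * paraconj x ^+ s).

Definition riesz_potential (m : nat) (x : 'rV[R]_m.+1) : R :=
  enorm (one_pt - x) ^- (m - 1).

End Series.

(* Main.v *)
(* Let a = (m-1)/2 and let c_n = (a)_n / n! be the Taylor coefficients of
   (1-z)^(-a). The k-th term of the series is the homogeneous part of degree k
   of the Cauchy product of sum_i c_i x^i and sum_j c_j xbar^j. Since
   x + xbar = u and x xbar = q are real (u = 2 x_0 and q = |x|^2), the relation
   (n+1) c_{n+1} = (a+n) c_n forces these homogeneous parts to be real numbers
   r_k given by a three-term recurrence in u and q. The recurrence holds equally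
   for a complex conjugate pair z, zbar with the same u and q, which bounds |r_k|
   by (2a)_k / k! |x|^k; so g(t) = sum_k r_k t^k is defined beyond t = 1, and the
   recurrence says (1 - u t + q t^2) g' = a (u - 2 q t) g. Hence
   g(t) (1 - u t + q t^2)^a is constant and
   g(1) = (1 - u + q)^(-a) = |1-x|^(-(m-1)).
   The Pochhammer symbols, being quotients of Euler integrals, require
   Gamma(a+1) = a Gamma(a) and 0 < Gamma(a) < oo for a > 0. *)
From HB Require Import structures.
Require Import Defs.
From mathcomp Require Import all_boot all_order all_algebra.
From mathcomp Require Import all_classical all_reals all_analysis.
From mathcomp Require Import measurable_realfun complex.
From mathcomp Require Import ring lra.
Import Order.TTheory GRing.Theory Num.Theory.
Import numFieldNormedType.Exports.
Local Open Scope classical_set_scope.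
Local Open Scope ring_scope.

Set Implicit Arguments.
Unset Strict Implicit.
Unset Printing Implicit Defensive.

(** * Euler's Gamma integral *)

Section OpenFTC.
Variable R : realType.
Notation mu := (@lebesgue_measure R).
Implicit Types (f F : R -> R) (a l : R).

Lemma continuous_measurable_itvoy f a :
  (forall x, a < x -> {for x, continuous f}) ->
  measurable_fun `]a, +oo[%classic f.
Proof.
move=> cf; apply: open_continuous_measurable_fun => //.
by apply/in_setP => x /=; rewrite in_itv /= andbT => /cf.
Qed.

(** Monotone convergence along the closed rays from [a + 1 / (n + 1)]. Only a right limit of the
    primitive at [a] is required, because Gamma integrands may blow up at 0. *)
Lemma ge0_continuous_FTC2oy f F a l l0 :
  (forall x, a < x -> 0 <= f x) ->
  (forall x, a < x -> {for x, continuous f}) ->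
  (forall x, a < x -> is_derive x (1 : R) F (f x)) ->
  F x @[x --> +oo] --> l -> F x @[x --> a^'+] --> l0 ->
  (\int[mu]_(x in `]a, +oo[) (f x)%:E = (l - l0)%:E)%E.
Proof.
move=> f0 cf dF Fl Fl0.
pose b n : R := a + n.+1%:R^-1; pose E n := `[b n, +oo[%classic.
have ab n : a < b n by rewrite ltrDl invr_gt0.
have EE : \bigcup_n E n = `]a, +oo[%classic.
  apply/seteqP; split=> x /=.
    move=> [n _]; rewrite /E /= !in_itv /= !andbT.
    exact: (lt_le_trans (ab _)).
  rewrite in_itv /= andbT => ax.
  have := cvgr_lt _ (@cvg_harmonic R) (x - a).
  rewrite subr_gt0 => /(_ _ ax) [N _ /(_ N (leqnn N)) /= xN].
  by exists N => //=; rewrite /E /= in_itv /= andbT /b -lerBrDl ltW.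
have mf n : measurable_fun (E n) (EFin \o f).
  apply/measurable_EFinP.
  apply: measurable_funS (continuous_measurable_itvoy cf) => //.
  by move=> x; rewrite /E /= !in_itv /= !andbT; exact: (lt_le_trans (ab _)).
have iE n : (\int[mu]_(x in E n) (f x)%:E = (l - F (b n))%:E)%E.
  rewrite (@ge0_continuous_FTC2y R f F (b n) l) ?EFinB//.
  - by move=> x bx; rewrite f0// (lt_le_trans (ab n)).
  - apply/continuous_within_itvcyP; split.
      move=> x; rewrite in_itv /= andbT => bx; apply: cf.
      exact: lt_trans (ab n) bx.
    by apply: cvg_at_right_filter; exact: cf.
  - by move=> x bx; have [] := dF x (lt_trans (ab n) bx).
  - apply: cvg_at_right_filter; apply: differentiable_continuous.
    by apply/derivable1_diffP; have [] := dF _ (ab n).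
  - move=> x; rewrite in_itv /= andbT => bx; rewrite derive1E.
    by have [_] := dF x (lt_trans (ab n) bx).
have : (\int[mu]_(x in E n) (f x)%:E @[n --> \oo] -->
    \int[mu]_(x in \bigcup_n E n) (f x)%:E)%E.
  apply: ge0_nondecreasing_set_cvg_integral => [|n||n x] //.
  - apply/nondecreasing_seqP => n; apply/subsetPset => x.
    rewrite /E /= !in_itv /= !andbT; apply: le_trans.
    by rewrite lerD2l lef_pV2 ?posrE// ler_nat.
  - exact: measurable_itv.
  - rewrite /E /= in_itv /= andbT lee_fin => bx.
    by rewrite f0// (lt_le_trans (ab n)).
rewrite EE; under eq_fun do rewrite iE.
move=> cvgI; apply: cvg_unique cvgI _ => //.
apply: cvg_EFin; first exact: nearW.
apply: cvgB; first exact: cvg_cst.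
move/cvg_at_rightP : Fl0; apply; split => //.
rewrite -[X in _ --> X]addr0; apply: cvgD; first exact: cvg_cst.
exact: cvg_harmonic.
Qed.

End OpenFTC.

(** * Finiteness, functional equation and positivity of Gamma *)

Section GammaFunction.
Variable R : realType.
Notation mu := (@lebesgue_measure R).
Implicit Types a t : R.

(** This is [ln s < s] at [s = t / (4 * a)], multiplied by [a] and exponentiated. The rate 1/4
    leaves room for further factors below [expR t]. *)
Lemma powR_le_expR a t : 0 < a -> 0 < t ->
  t `^ a <= expR (a * ln (4 * a)) * expR (t / 4).
Proof.
move=> a0 t0; have a4 : 0 < 4 * a by rewrite mulr_gt0.
rewrite /powR gt_eqF// -expRD ler_expR.
have := ltW (ln_sublinear (divr_gt0 t0 a4)).
rewrite ln_div ?posrE// lerBlDr -(ler_pM2l a0) => /le_trans; apply.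
by rewrite le_eqVlt; apply/orP; left; apply/eqP; field; rewrite gt_eqF.
Qed.

Lemma cvgr_powR_pinfty a : 0 < a -> t `^ a @[t --> +oo] --> +oo.
Proof.
move=> a0; apply/cvgryPge => A.
near=> t.
have t0 : 0 < t by near: t; exact: nbhs_pinfty_gt.
have At : Num.max A 1 `^ a^-1 <= t by near: t; exact: nbhs_pinfty_ge.
have A1 : 0 <= Num.max A 1 by rewrite le_max ler01 orbT.
rewrite (@le_trans _ _ (Num.max A 1))// ?le_max ?lexx//.
rewrite -[leLHS](powRr1 A1) -(mulVf (lt0r_neq0 a0)) powRrM.
by rewrite ge0_ler_powR ?nnegrE ?powR_ge0 ?(ltW a0) ?(ltW t0).
Unshelve. all: by end_near. Qed.

Definition gamma_integrand a t := t `^ (a - 1) * expR (- t).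

(* The derivative of [- (1 + t ^ a)^-1]: up to a constant it dominates the Gamma
   integrands at a and a + 1 while having a bounded, explicit primitive, which
   keeps every integral below nonnegative. *)
Let phi a t := a * t `^ (a - 1) / (1 + t `^ a) ^+ 2.

Let den_gt0 a t : 0 < 1 + t `^ a.
Proof. by rewrite ltr_wpDr ?powR_ge0. Qed.

Let is_derive_phi a t : 0 < t ->
  is_derive t (1 : R) (fun t => - (1 + t `^ a)^-1) (phi a t).
Proof.
move=> t0.
have dP := is_derive1_powR a t0.
have dD : is_derive t (1 : R) (fun t => 1 + t `^ a) (a * t `^ (a - 1)).
  by apply: is_derive_eq; rewrite add0r mul1r.
have D0 : 1 + t `^ a != 0 by rewrite gt_eqF.
apply: is_derive_eq.
by rewrite /phi /GRing.scale /=; field.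
Qed.

Let is_derive_powR_expR a t : 0 < t ->
  is_derive t (1 : R) (fun t => t `^ a * expR (- t))
    (a * gamma_integrand a t - gamma_integrand (a + 1) t).
Proof.
move=> t0; have dP := is_derive1_powR a t0.
have dE : is_derive t (1 : R) (fun t => expR (- t)) (- expR (- t)).
  by apply: is_derive_eq; rewrite mulrN1.
apply: (is_derive_eq (is_deriveM dP dE)).
rewrite /GRing.scale /= /gamma_integrand addrK; ring.
Qed.

Let powR_continuous a t : 0 < t -> {for t, continuous (fun t => t `^ a)}.
Proof.
move=> t0; apply: differentiable_continuous; apply/derivable1_diffP.
by have [] := is_derive1_powR a t0.
Qed.

Let gamma_integrand_continuous a t :
  0 < t -> {for t, continuous (gamma_integrand a)}.
Proof.
move=> t0; apply: differentiable_continuous; apply/derivable1_diffP.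
by have [] := is_derive_powR_expR (a - 1) t0.
Qed.

Let phi_continuous a t : 0 < t -> {for t, continuous (phi a)}.
Proof.
move=> t0; rewrite /continuous_at /phi; apply: cvgM.
  by apply: cvgMl_tmp; exact: powR_continuous.
apply: cvgV; first by rewrite expf_neq0// gt_eqF.
rewrite expr2.
rewrite -[X in X @ _ --> _]/((fun x => 1 + x `^ a) \* (fun x => 1 + x `^ a)).
by apply: cvgM; (apply: cvgD; [exact: cvg_cst|exact: powR_continuous]).
Qed.

Let gamma_integrand_ge0 a t : 0 <= gamma_integrand a t.
Proof. by rewrite mulr_ge0 ?powR_ge0 ?expR_ge0. Qed.

Let phi_ge0 a t : 0 < a -> 0 <= phi a t.
Proof. by move=> a0; rewrite divr_ge0 ?sqr_ge0// mulr_ge0 ?powR_ge0 ?ltW. Qed.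

Let gamma_integrandS a t : 0 < a -> 0 < t ->
  gamma_integrand (a + 1) t = t * gamma_integrand a t.
Proof.
by move=> a0 t0; rewrite /gamma_integrand mulrA addrK mulr_powRB1// ltW.
Qed.

(** With [e = expR (t / 4)], both [1 + t] and [1 + t ^ a] are at most constants times [e], so
    [(1 + t) (1 + t ^ a)^2] is of order [e ^ 3], below [expR t = e ^ 4]. *)
Let dominated a : 0 < a -> exists2 C : R, 0 < C &
  forall t, 0 < t ->
    gamma_integrand (a + 1) t + gamma_integrand a t <= C * phi a t.
Proof.
move=> a0; pose B := 1 + expR (a * ln (4 * a)).
have B0 : 0 < B by rewrite addr_gt0// expR_gt0.
exists (4 * B ^+ 2 / a); first by rewrite divr_gt0// mulr_gt0// exprn_gt0.
move=> t t0; pose e := expR (t / 4).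
have e1 : 1 <= e by rewrite -expR0 ler_expR divr_ge0// ltW.
have e0 : 0 < e := expR_gt0 _.
have te : 1 + t <= 4 * e by have := expR_ge1Dx (t / 4); rewrite -/e; lra.
have pe : 1 + t `^ a <= B * e.
  by have := powR_le_expR a0 t0; rewrite -/e /B mulrDl mul1r; lra.
have et : expR t = e ^+ 4 by rewrite -expRM_natl; congr expR; field.
rewrite gamma_integrandS// -[X in _ + X]mul1r -mulrDl addrC.
have -> : 4 * B ^+ 2 / a * phi a t =
    t `^ (a - 1) * (4 * B ^+ 2 / (1 + t `^ a) ^+ 2).
  by rewrite /phi; field; rewrite !gt_eqF.
rewrite /gamma_integrand mulrCA ler_wpM2l ?powR_ge0//.
rewrite expRN ler_pdivlMr ?exprn_gt0// mulrAC ler_pdivrMr ?expR_gt0// et.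
apply: (@le_trans _ _ (4 * e * (B * e) ^+ 2)).
  rewrite ler_pM ?sqr_ge0//; first by rewrite addr_ge0 ?(ltW t0).
  by rewrite lerXn2r ?nnegrE ?(ltW (den_gt0 _ _)) ?mulr_ge0 ?(ltW B0) ?(ltW e0).
rewrite (_ : _ * _ = 4 * B ^+ 2 * e ^+ 3); last by ring.
by rewrite ler_pM2l ?mulr_gt0 ?exprn_gt0// ler_weXn2l.
Qed.

Let I a := (\int[mu]_(t in `]0%R, +oo[) (gamma_integrand a t)%:E)%E.

Let measurable_gamma_integrand a :
  measurable_fun (`]0, +oo[ : set R) (EFin \o gamma_integrand a).
Proof.
apply/measurable_EFinP; apply: continuous_measurable_itvoy => t.
exact: gamma_integrand_continuous.
Qed.

Let cvg_phi_primitivey a : 0 < a -> - (1 + t `^ a)^-1 @[t --> +oo] --> (0 : R).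
Proof.
move=> a0; rewrite -oppr0; apply: cvgN; apply/gtr0_cvgV0; last first.
  apply/cvgryPge => A; have /cvgryPge/(_ A) := cvgr_powR_pinfty a0.
  by apply: filterS => t /le_trans; apply; rewrite lerDr.
by near=> t; rewrite den_gt0.
Unshelve. all: by end_near. Qed.

Let cvg_phi_primitive0 a : 0 < a ->
  - (1 + t `^ a)^-1 @[t --> 0^'+] --> (-1 : R).
Proof.
move=> a0; apply: cvgN; rewrite -[X in _ --> X]invr1; apply: cvgV => //.
by rewrite -[X in _ --> X]addr0; apply: cvgD; [exact: cvg_cst|exact: powR_cvg0].
Qed.

Let integral_phi a : 0 < a -> (\int[mu]_(t in `]0%R, +oo[) (phi a t)%:E = 1)%E.
Proof.
move=> a0; rewrite -[1%:E](_ : (0 - (-1))%:E = _); last by rewrite sub0r opprK.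
apply: (@ge0_continuous_FTC2oy R _ (fun t => - (1 + t `^ a)^-1)).
- by move=> t t0; exact: phi_ge0.
- by move=> t; exact: phi_continuous.
- by move=> t; exact: is_derive_phi.
- exact: cvg_phi_primitivey.
- exact: cvg_phi_primitive0.
Qed.

Let cvg_powR_expR0 a : 0 < a -> t `^ a * expR (- t) @[t --> 0^'+] --> (0 : R).
Proof.
move=> a0; rewrite -[X in _ --> X](mul0r (expR (- 0))).
apply: cvgM; first exact: powR_cvg0.
apply: cvg_at_right_filter; apply: continuous_comp; first exact: continuousN.
exact: continuous_expR.
Qed.

(** One factor [expR (t / 4)] of [expR t] absorbs the power up to the constant [B], and another one
    supplies the vanishing factor [4 / t]. *)
Let cvg_powR_expRy a : 0 < a -> t `^ a * expR (- t) @[t --> +oo] --> (0 : R).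
Proof.
move=> a0; pose B := expR (a * ln (4 * a)).
have : B * (4 * t^-1) @[t --> +oo] --> (0 : R).
  rewrite -[X in _ --> X](mulr0 B); apply: cvgMl_tmp.
  rewrite -[X in _ --> X](mulr0 4); apply: cvgMl_tmp.
  apply/gtr0_cvgV0; last exact: cvg_id.
  exact: nbhs_pinfty_gt.
apply: (squeeze_cvgr _ (cvg_cst 0)); near=> t.
have t0 : 0 < t by near: t; exact: nbhs_pinfty_gt.
rewrite mulr_ge0 ?powR_ge0 ?expR_ge0//=.
rewrite expRN ler_pdivrMr ?expR_gt0// (le_trans (powR_le_expR a0 t0))//.
rewrite -mulrA ler_pM2l ?expR_gt0//.
have te : t <= 4 * expR (t / 4) by have := expR_ge1Dx (t / 4); lra.
rewrite mulrAC ler_pdivlMr//.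
apply: (@le_trans _ _ (4 * expR (t / 4) * expR (t / 4))).
  by rewrite [leLHS]mulrC ler_pM2r ?expR_gt0.
rewrite -mulrA ler_pM2l// -expRD ler_expR; lra.
Unshelve. all: by end_near. Qed.

(** Integration by parts kept nonnegative: adding the integral [H] of [C * phi a] minus the
    integrand at [a + 1] turns both [a * I a] and [I (a + 1)] into [C]. Hence everything is finite
    and [H] can be subtracted. *)
Let gamma_integral a : 0 < a ->
  (I a \is a fin_num /\ I (a + 1) = a%:E * I a)%E.
Proof.
move=> a0; have [C C0 dom] := dominated a0.
pose h t := C * phi a t - gamma_integrand (a + 1) t.
have h0 t : 0 < t -> 0 <= h t.
  move=> t0; rewrite subr_ge0 (le_trans _ (dom t t0))// lerDl.
  exact: gamma_integrand_ge0.
have hc t : 0 < t -> {for t, continuous h}.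
  move=> t0; rewrite /continuous_at /h; apply: cvgB.
    by apply: cvgMl_tmp; exact: phi_continuous.
  exact: gamma_integrand_continuous.
have mh : measurable_fun (`]0, +oo[ : set R) (EFin \o h).
  by apply/measurable_EFinP; exact: continuous_measurable_itvoy.
have mD : measurable (`]0, +oo[ : set R) by exact: measurable_itv.
pose H := (\int[mu]_(t in `]0%R, +oo[) (h t)%:E)%E.
(* The summed integrand is the derivative of [t ^ a * expR (- t) - C / (1 + t ^ a)], which goes from
   [- C] at 0 to 0 at infinity. *)
have E1 : (a%:E * I a + H = C%:E)%E.
  rewrite /I /H -ge0_integralZl_EFin//; last 3 first.
  - by move=> t _; rewrite lee_fin gamma_integrand_ge0.
  - exact: measurable_gamma_integrand.
  - exact: ltW.
  rewrite -ge0_integralD//; last 3 first.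
  - by move=> t _; rewrite -EFinM lee_fin mulr_ge0 ?gamma_integrand_ge0// ltW.
  - by apply: measurable_funeM; exact: measurable_gamma_integrand.
  - by move=> t /=; rewrite in_itv /= andbT lee_fin; exact: h0.
  under eq_integral do rewrite -EFinM -EFinD.
  rewrite -[C](_ : 0 - (- C) = _); last by rewrite sub0r opprK.
  apply: (@ge0_continuous_FTC2oy R _
    (fun t => t `^ a * expR (- t) + C * (- (1 + t `^ a)^-1))).
  - move=> t t0; rewrite addr_ge0 ?h0//.
    by rewrite mulr_ge0 ?gamma_integrand_ge0 ?(ltW a0).
  - move=> t t0; rewrite /continuous_at; apply: cvgD; last exact: hc.
    by apply: cvgMl_tmp; exact: gamma_integrand_continuous.
  - move=> t t0; have d1 := is_derive_powR_expR a t0.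
    have d2 := is_derive_phi a t0.
    apply: is_derive_eq; rewrite /h /GRing.scale /=; ring.
  - rewrite -[X in _ --> X](addr0 0) -[X in _ --> _ + X](mulr0 C); apply: cvgD.
      exact: cvg_powR_expRy.
    by apply: cvgMl_tmp; exact: cvg_phi_primitivey.
  - rewrite -[X in _ --> X]add0r -mulrN1; apply: cvgD.
      exact: cvg_powR_expR0.
    by apply: cvgMl_tmp; exact: cvg_phi_primitive0.
have E2 : (I (a + 1) + H = C%:E)%E.
  rewrite /I /H -ge0_integralD//; last 3 first.
  - by move=> t _; rewrite lee_fin gamma_integrand_ge0.
  - exact: measurable_gamma_integrand.
  - by move=> t /=; rewrite in_itv /= andbT lee_fin; exact: h0.
  under eq_integral do rewrite -EFinD /h addrC subrK EFinM.
  rewrite ge0_integralZl_EFin//; last 3 first.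
  - by move=> t _; rewrite lee_fin phi_ge0.
  - apply/measurable_EFinP; apply: continuous_measurable_itvoy => t.
    exact: phi_continuous.
  - exact: ltW.
  by rewrite integral_phi// mule1.
have Iab b : (0 <= I b)%E.
  by apply: integral_ge0 => t _; rewrite lee_fin gamma_integrand_ge0.
have H0 : (0 <= H)%E.
  by apply: integral_ge0 => t /=; rewrite in_itv /= andbT lee_fin; exact: h0.
have Hfin : H \is a fin_num.
  by rewrite ge0_fin_numE// (@le_lt_trans _ _ C%:E) ?ltry// -E2 leeDr.
split.
  rewrite ge0_fin_numE// ltey; apply/eqP => Iy; move: E1.
  rewrite Iy gt0_muley ?lte_fin// addye//.
  by rewrite gt_eqF// (lt_le_trans _ H0)// ltNyr.
by rewrite -[LHS](addeK _ Hfin) E2 -E1 (addeK _ Hfin).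
Qed.

Let GammaE a : Gamma a = fine (I a).
Proof. by []. Qed.

Lemma GammaS a : 0 < a -> Gamma (a + 1) = a * Gamma a.
Proof.
by move=> /gamma_integral [Ifin IS]; rewrite !GammaE IS fineM.
Qed.

Lemma Gamma_gt0 a : 0 < a -> 0 < Gamma a.
Proof.
move=> a0; have [Ifin _] := gamma_integral a0.
rewrite GammaE fine_gt0// -ge0_fin_numE ?Ifin ?andbT; last first.
  by apply: integral_ge0 => t _; rewrite lee_fin gamma_integrand_ge0.
(* On [1, 2] one has [t ^ (a - 1) = t ^ a / t >= 1 / 2] and [expR (- t) >= expR (- 2)]. *)
have c0 : 0 < expR (-2) / 2 :> R by rewrite divr_gt0 ?expR_gt0.
have mI : measurable (`[1, 2] : set R) by exact: measurable_itv.
have : (\int[mu]_(t in `[1%R, 2%R]) (expR (-2) / 2)%:E <=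
    \int[mu]_(t in `[1%R, 2%R]) (gamma_integrand a t)%:E)%E.
  apply: ge0_le_integral => //.
  - apply: measurable_funS (measurable_gamma_integrand a) => //.
    move=> t /=; rewrite !in_itv /= andbT => /andP[t1 _].
    by rewrite (lt_le_trans _ t1).
  - move=> t /=; rewrite in_itv /= => /andP[t1 t2]; rewrite lee_fin.
    have t0 : 0 < t by rewrite (lt_le_trans _ t1).
    rewrite /gamma_integrand mulrC ler_pM ?expR_ge0// ?ler_expR ?lerN2//.
    rewrite -(ler_pM2l t0) mulr_powRB1// ?(ltW t0)//.
    apply: (@le_trans _ _ 1); first by rewrite ler_pdivrMr// mul1r.
    have := ge0_ler_powR (ltW a0) (x := 1) (y := t).
    by rewrite !nnegrE ler01 (ltW t0) powR1; apply.
rewrite integral_cst//= lebesgue_measure_itv /= lte_fin ltr1n => lec.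
apply: (@lt_le_trans _ _ ((expR (-2) / 2)%:E * (2%:E - 1%:E))%E).
  by rewrite -EFinB -EFinM lte_fin mulr_gt0// subr_gt0 ltr1n.
apply: (le_trans lec); apply: ge0_subset_integral => //.
- exact: measurable_gamma_integrand.
- by move=> t _; rewrite lee_fin gamma_integrand_ge0.
- move=> t /=; rewrite !in_itv /= andbT => /andP[t1 _].
  by rewrite (lt_le_trans _ t1).
Qed.

Lemma pochhammer0 a : 0 <= a -> pochhammer a 0 = 1.
Proof.
rewrite /pochhammer; case: eqVneq => // a_neq0 a_ge0.
by rewrite addr0 divff// gt_eqF// Gamma_gt0// lt_neqAle eq_sym a_neq0.
Qed.

Lemma pochhammerS a n : 0 < a ->
  pochhammer a n.+1 = (a + n%:R) * pochhammer a n.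
Proof.
move=> a0; rewrite /pochhammer gt_eqF// -natr1 addrA GammaS ?mulrA//.
by rewrite ltr_wpDr.
Qed.

Lemma pochhammer_gt0 a n : 0 < a -> 0 < pochhammer a n.
Proof.
move=> a0; elim: n => [|n IH]; first by rewrite pochhammer0// ltW.
by rewrite pochhammerS// mulr_gt0// ltr_wpDr.
Qed.

End GammaFunction.

(** * The Cauchy product of two binomial series *)

Section CauchyProduct.
Variables (R : comNzRingType) (A : algType R) (a : R) (c : nat -> R).
Variables (X Y : A) (u q : R).
Hypothesis c_rec : forall n, n.+1%:R * c n.+1 = (a + n%:R) * c n.
Hypothesis addXY : X + Y = u%:A.
Hypothesis mulXY : X * Y = q%:A.

(** The weight [w] covers the homogeneous part itself and its images under the Euler operators X
    d/dX ([cauchyl]) and Y d/dY ([cauchyr]). *)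
Definition cauchy_term (w : nat -> nat -> R) k : A :=
  \sum_(s < k.+1)
    (w (k - s)%N s * (c (k - s) * c s)) *: (X ^+ (k - s) * Y ^+ s).

Definition cauchy_prod := cauchy_term (fun _ _ => 1).
Definition cauchyl := cauchy_term (fun i _ => i%:R).
Definition cauchyr := cauchy_term (fun _ j => j%:R).

Lemma cauchylDr k : cauchyl k + cauchyr k = k%:R *: cauchy_prod k.
Proof.
rewrite -big_split scaler_sumr; apply: eq_bigr => s _ /=.
by rewrite -scalerDl -mulrDl -natrD subnK -1?ltnS// mul1r scalerA.
Qed.

(** The weight kills the last term, and [c_rec] applied to the left coefficient frees one factor [X]
    from the others. *)
Lemma cauchylS k : cauchyl k.+1 = X * (cauchyl k + a *: cauchy_prod k).
Proof.
rewrite /cauchyl /cauchy_term big_ord_recr /= subnn !mul0r scale0r addr0.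
rewrite scaler_sumr -big_split mulr_sumr; apply: eq_bigr => s _ /=.
rewrite subSn -1?ltnS// mul1r scalerA -scalerDl -scalerAr [X * _]mulrA -exprS.
by rewrite mulrA c_rec -mulrA mulrDl addrC.
Qed.

(** [Y = u - X] with [u] a scalar, so [X] and [Y] commute. *)
Lemma mulYX : Y * X = q%:A.
Proof.
have -> : Y = u%:A - X by rewrite -addXY addrC addKr.
by rewrite mulrBl mulr_algl -mulr_algr -mulrBr -addXY addrC addKr.
Qed.

Lemma cauchyrS k : cauchyr k.+1 = Y * (cauchyr k + a *: cauchy_prod k).
Proof.
have XY : GRing.comm Y X by rewrite /GRing.comm mulYX mulXY.
rewrite /cauchyr /cauchy_term big_ord_recl /= !mul0r scale0r add0r.
rewrite scaler_sumr -big_split mulr_sumr; apply: eq_bigr => s _ /=.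
rewrite subSS mul1r scalerA -scalerDl -scalerAr [Y * _]mulrA.
rewrite (commrX (k - s)%N XY) -[X ^+ _ * Y * _]mulrA -exprS.
by congr (_ *: _); rewrite /bump leq0n add1n mulrCA c_rec; ring.
Qed.

(** Euler's relation [cauchylDr] is used in degrees k + 2, k + 1 and k. In between, [X = u - Y] in
    front of [cauchyl] and [Y = u - X] in front of [cauchyr] create the products [Y * X] and
    [X * Y], which are the scalar [q]. *)
Lemma cauchy_prod_rec k :
  k.+2%:R *: cauchy_prod k.+2 =
  ((a + k.+1%:R) * u) *: cauchy_prod k.+1
  - ((a + a + k%:R) * q) *: cauchy_prod k.
Proof.
have XA : X * cauchyl k.+1
    = u *: cauchyl k.+1 - q *: (cauchyl k + a *: cauchy_prod k).
  rewrite {1}(_ : X = u%:A - Y) ?mulrBl ?mulr_algl; last first.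
    by rewrite -addXY addrK.
  by rewrite {2}cauchylS mulrA mulYX mulr_algl.
have YB : Y * cauchyr k.+1
    = u *: cauchyr k.+1 - q *: (cauchyr k + a *: cauchy_prod k).
  rewrite {1}(_ : Y = u%:A - X) ?mulrBl ?mulr_algl; last first.
    by rewrite -addXY addrC addKr.
  by rewrite {2}cauchyrS mulrA mulXY mulr_algl.
rewrite -cauchylDr cauchylS cauchyrS 2!mulrDr XA YB addrACA.
rewrite -[in X in _ + X]mulrDl addXY mulr_algl addrACA -opprD.
rewrite -!scalerDr cauchylDr addrACA cauchylDr.
rewrite !scalerA addrAC -scalerDl -!scalerDl scalerA.
by congr (_ *: _ - _ *: _); ring.
Qed.

End CauchyProduct.

(** * Reduction of the Cauchy product to a scalar recurrence *)

Section CauchyRec.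
Variables (F : numFieldType) (a u q : F) (r : nat -> F).
Hypothesis r0 : r 0 = 1.
Hypothesis r1 : r 1 = a * u.
Hypothesis r_rec : forall k, k.+2%:R * r k.+2 =
  (a + k.+1%:R) * u * r k.+1 - (a + a + k%:R) * q * r k.

(** The algebra is arbitrary because this serves twice: for paravectors in the Clifford algebra, and
    for a conjugate pair of complex numbers with the same [u] and [q]. *)
Lemma cauchy_prodE (A : algType F) (c : nat -> F) (X Y : A) :
  c 0%N = 1 -> (forall n, n.+1%:R * c n.+1 = (a + n%:R) * c n) ->
  X + Y = u%:A -> X * Y = q%:A ->
  forall k, cauchy_prod c X Y k = (r k)%:A.
Proof.
move=> c0 c_rec addXY mulXY k.
suff [] : cauchy_prod c X Y k = (r k)%:A
    /\ cauchy_prod c X Y k.+1 = (r k.+1)%:A.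
  by [].
elim: k => [|k [IH1 IH2]].
  split.
    by rewrite /cauchy_prod /cauchy_term big_ord1 /= c0 !mulr1 expr0 r0.
  have c1 : c 1%N = a by have := c_rec 0%N; rewrite c0 mul1r mulr1 addr0.
  rewrite /cauchy_prod /cauchy_term !big_ord_recl big_ord0 /= /bump /=.
  rewrite c0 c1 !(mul1r, mulr1, expr1, expr0) addr0 -scalerDr addXY.
  by rewrite scalerA r1.
split=> //; have k2 : k.+2%:R != 0 :> F by rewrite pnatr_eq0.
apply: (scalerI k2); rewrite (cauchy_prod_rec c_rec addXY mulXY) IH1 IH2.
by rewrite !scalerA -scalerBl r_rec.
Qed.
End CauchyRec.

(** * Majorant coefficients *)

Section Majorant.
Variables (F : numFieldType) (a : F) (c : nat -> F).
Hypothesis c_rec : forall n, n.+1%:R * c n.+1 = (a + n%:R) * c n.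

(** When [c 0 = 1], these are the Taylor coefficients [(2a)_k / k!] of (1 - z)^(-2a). *)
Definition cauchy_coef k : F := \sum_(s < k.+1) c (k - s)%N * c s.

(** Euler's relation for the Cauchy product at [X = Y = 1]. *)
Lemma cauchy_coef_rec k :
  k.+1%:R * cauchy_coef k.+1 = (a + a + k%:R) * cauchy_coef k.
Proof.
have E n : cauchy_prod c (1 : F^o) (1 : F^o) n = cauchy_coef n.
  apply: eq_bigr => s _; rewrite !expr1n mulr1 mul1r.
  exact: mulr1.
have XX : (1 : F^o) * 1 = 1%:A by rewrite mulr1 scale1r.
have XY : (1 : F^o) + 1 = (1 + 1)%:A by rewrite scalerDl scale1r.
have := cauchylDr c (1 : F^o) (1 : F^o) k.+1.
rewrite (cauchylS _ _ c_rec) (cauchyrS c_rec XY XX) !mul1r addrACA cauchylDr.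
rewrite -scalerDl -scalerDl !E => H.
by rewrite -[LHS]H addrC.
Qed.
End Majorant.

(** * The bound from a complex conjugate pair *)

Section Bound.
Variables (R : rcfType) (a u q : R) (r c : nat -> R).
Local Open Scope complex_scope.
Hypothesis r0 : r 0 = 1.
Hypothesis r1 : r 1 = a * u.
Hypothesis r_rec : forall k, k.+2%:R * r k.+2 =
  (a + k.+1%:R) * u * r k.+1 - (a + a + k%:R) * q * r k.
Hypothesis c0 : c 0 = 1.
Hypothesis c_rec : forall n, n.+1%:R * c n.+1 = (a + n%:R) * c n.
Hypothesis c_ge0 : forall n, 0 <= c n.
Hypothesis uq : u ^+ 2 <= 4 * q.

Lemma cauchy_bound k : `|r k| <= cauchy_coef c k * Num.sqrt q ^+ k.
Proof.
(* [y] is the imaginary part of the roots [z], [w] of T^2 - u T + q. By [uq] they are conjugate, of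
   modulus [Num.sqrt q], so the triangle inequality gives the bound. *)
pose y : R := Num.sqrt (q - (u / 2) ^+ 2).
have y2 : y ^+ 2 = q - (u / 2) ^+ 2.
    rewrite sqr_sqrtr// (_ : _ - _ = (4 * q - u ^+ 2) / 4); last by field.
    by rewrite divr_ge0// subr_ge0.
pose z : R[i]^o := (u / 2) +i* y; pose w : R[i]^o := (u / 2) -i* y.
have zw : z + w = u%:C%:A.
  by rewrite -[RHS]mulr1 /GRing.scale /= mulr1; simpc; congr (_ +i* _); field.
have zw' : z * w = q%:C%:A.
  rewrite /GRing.scale /= mulr1; simpc; congr (_ +i* _); last ring.
  by rewrite -[y * y]expr2 y2; field.
have C0 : (c 0)%:C = 1 by rewrite c0.
have Cr n : n.+1%:R * (c n.+1)%:C = (a%:C + n%:R) * (c n)%:C.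
  by rewrite -!(rmorph_nat (real_complex R)) -rmorphD -!rmorphM c_rec.
have R0 : (r 0)%:C = 1 by rewrite r0.
have R1 : (r 1)%:C = a%:C * u%:C by rewrite r1 rmorphM.
have RR n : n.+2%:R * (r n.+2)%:C = (a%:C + n.+1%:R) * u%:C * (r n.+1)%:C
    - (a%:C + a%:C + n%:R) * q%:C * (r n)%:C.
  by rewrite -!(rmorph_nat (real_complex R)) -!rmorphD -!rmorphM r_rec rmorphB.
have := cauchy_prodE R0 R1 RR C0 Cr zw zw' k.
rewrite /GRing.scale /= mulr1 => E.
have q0 : 0 <= q by rewrite -(pmulr_rge0 q (ltr0n R 4)) (le_trans (sqr_ge0 u)).
have nz : `|z| = (Num.sqrt q)%:C.
  by rewrite normc_def /= y2 addrC subrK.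
have nw : `|w| = (Num.sqrt q)%:C.
  by rewrite normc_def /= sqrrN y2 addrC subrK.
have nC (t : R) : `|t%:C| = `|t|%:C.
  by rewrite normc_def /= expr0n addr0 sqrtr_sqr.
rewrite -lecR -nC -E (le_trans (ler_norm_sum _ _ _))//.
rewrite /cauchy_coef mulr_suml rmorph_sum; apply: ler_sum => s _.
rewrite mul1r /GRing.scale /= !normrM !normrX nz nw !nC !ger0_norm//.
by rewrite -exprD subnK -1?ltnS// !rmorphM rmorphXn.
Qed.
End Bound.

(** * The generating function *)

Section RatioTest.
Variable R : realType.
Implicit Types (w d : R^nat) (l K : R).

Lemma ratio_test w l : (forall n, 0 < w n) ->
  w n.+1 / w n @[n --> \oo] --> l -> l < 1 -> cvgn (series w).
Proof.
move=> w_gt0 wl l1; pose s := (l + 1) / 2.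
have ls : l < s by rewrite /s; lra.
have s1 : s < 1 by rewrite /s; lra.
have [N _ Ns] : \forall n \near \oo, w n.+1 / w n < s by exact: (cvgr_lt _ wl).
have {}Ns n : (N <= n)%N -> w n.+1 <= s * w n.
  by move=> /Ns /=; rewrite ltr_pdivrMr// => /ltW.
have s_gt0 : 0 < s.
  by rewrite -(pmulr_lgt0 _ (w_gt0 N)) (lt_le_trans (w_gt0 N.+1))// Ns.
(* Zeroing the first [N] terms makes the comparison with a geometric series of ratio [s] valid at
   every index. *)
pose w' n := if (n < N)%N then 0 else w n.
rewrite -(is_cvg_series_restrict N).
rewrite (_ : (fun _ => _) = fun n => \sum_(N <= k < n) w' k); last first.
  apply/funext => n; apply: eq_big_nat => k /andP[Nk _].
  by rewrite /w' ltnNge Nk.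
rewrite is_cvg_series_restrict.
have wN0 : 0 <= w N / s ^+ N by rewrite divr_ge0 ?exprn_ge0// ltW.
apply: (@series_le_cvg _ _ (geometric (w N / s ^+ N) s)) => [n|n|n|] /=.
- by rewrite /w'; case: ifP => // _; exact: ltW.
- by rewrite mulr_ge0 ?exprn_ge0// ltW.
- rewrite /w'; case: ltnP => [_|]; first by rewrite mulr_ge0 ?exprn_ge0// ltW.
  elim: n => [|n IH].
    by rewrite leqn0 => /eqP->; rewrite expr0 divr1 mulr1.
  rewrite leq_eqVlt => /predU1P[<-|Nn].
    by rewrite divfK// expf_neq0 ?gt_eqF.
  rewrite (le_trans (Ns _ Nn))// exprS mulrCA ler_pM2l//; exact: IH.
- by apply: is_cvg_geometric_series; rewrite ger0_norm ?(ltW s_gt0).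
Qed.

(** The ratio condition bears on a positive majorant since [d] itself may vanish. It guarantees a
    radius of convergence of at least 1/l when [l] is positive. *)
Definition ratio_dominated l d :=
  exists2 w, (forall n, 0 < w n) /\ (forall n, `|d n| <= w n) &
    w n.+1 / w n @[n --> \oo] --> l.

Lemma is_cvg_ratio_dominated l d K : ratio_dominated l d ->
  0 < K -> l * K < 1 -> cvgn (pseries d K).
Proof.
move=> [w [w0 dw] wl] K0 lK; apply: normed_cvg.
apply: (@series_le_cvg _ _ (fun n => w n * K ^+ n)) => [n|n|n|] /=.
- by [].
- by rewrite mulr_ge0 ?exprn_ge0// ltW.
- rewrite normrM [`|K ^+ n|]ger0_norm; last by rewrite exprn_ge0// ltW.
  by rewrite ler_pM2r ?exprn_gt0.
- apply: (@ratio_test _ (l * K)) => // [n|].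
    by rewrite mulr_gt0 ?exprn_gt0.
  rewrite (_ : (fun _ => _) = fun n => w n.+1 / w n * K); last first.
    apply/funext => n; rewrite exprS; field.
    by rewrite expf_neq0 ?gt_eqF.
  by apply: cvgMr_tmp; exact: wl.
Qed.

Lemma cvg_shift_ratio (b : R) : (b + n%:R) / n.+1%:R @[n --> \oo] --> (1 : R).
Proof.
rewrite (_ : (fun _ => _) = fun n => 1 + (b - 1) * harmonic n); last first.
  apply/funext => n /=; rewrite -[n.+1%:R]natr1; field.
  by rewrite natr1 pnatr_eq0.
rewrite -[X in _ --> X](_ : 1 + (b - 1) * 0 = 1); last by rewrite mulr0 addr0.
apply: cvgD; first exact: cvg_cst.
by apply: cvgMl_tmp; exact: cvg_harmonic.
Qed.

(** Differentiation multiplies the ratios by (n + 2) / (n + 1), which tends to 1. *)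
Lemma ratio_dominated_diffs l d :
  ratio_dominated l d -> ratio_dominated l (pseries_diffs d).
Proof.
move=> [w [w0 dw] wl]; exists (pseries_diffs w).
  split=> n; first by rewrite mulr_gt0.
  by rewrite /pseries_diffs normrM ger0_norm// ler_pM2l.
rewrite (_ : (fun _ => _) =
    fun n => (2 + n%:R) / n.+1%:R * (w n.+2 / w n.+1)); last first.
  apply/funext => n.
  rewrite /pseries_diffs -[n.+2%:R]natr1 -[n.+1%:R]natr1; field.
  by rewrite natr1 pnatr_eq0 gt_eqF.
rewrite -[l]mul1r; apply: cvgM; first exact: cvg_shift_ratio.
by rewrite (cvg_shiftS (fun n => w n.+1 / w n)).
Qed.

End RatioTest.

(** * The differential equation and the value at 1 *)

Section GeneratingFunction.
Variables (R : realType) (a u q : R) (r c : R^nat).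
Hypothesis r0 : r 0 = 1.
Hypothesis r1 : r 1 = a * u.
Hypothesis r_rec : forall k, k.+2%:R * r k.+2 =
  (a + k.+1%:R) * u * r k.+1 - (a + a + k%:R) * q * r k.
Hypothesis c0 : c 0 = 1.
Hypothesis c_rec : forall n, n.+1%:R * c n.+1 = (a + n%:R) * c n.
Hypothesis a_gt0 : 0 < a.
Hypothesis uq : u ^+ 2 <= 4 * q.
Hypothesis q1 : q < 1.

Let d := pseries_diffs r.
Let D (t : R) : R := 1 - u * t + q * t ^+ 2.
Let rho := Num.sqrt q.

Let q_ge0 : 0 <= q.
Proof. by rewrite -(pmulr_rge0 q (ltr0n R 4)) (le_trans (sqr_ge0 u)). Qed.

Let rho_lt1 : rho < 1.
Proof. by rewrite -sqrtr1 ltr_sqrt. Qed.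

Let c_gt0 n : 0 < c n.
Proof.
elim: n => [|n IH]; first by rewrite c0.
by rewrite -(pmulr_rgt0 _ (ltr0Sn R n)) c_rec mulr_gt0// ltr_wpDr.
Qed.

Let cauchy_coef_gt0 k : 0 < cauchy_coef c k.
Proof.
rewrite /cauchy_coef big_ord_recl ltr_wpDr ?mulr_gt0//.
by apply: sumr_ge0 => i _; rewrite mulr_ge0// ltW.
Qed.

(** A positive [t] replaces [rho], which is 0 when [q = 0] and would then spoil the positivity of
    the majorant. *)
Let ratio_dominated_r (t : R) : rho <= t -> 0 < t -> ratio_dominated t r.
Proof.
move=> rt t0; exists (fun k => cauchy_coef c k * t ^+ k).
  split=> k; first by rewrite mulr_gt0 ?exprn_gt0.
  have := cauchy_bound r0 r1 r_rec c0 c_rec (fun n => ltW (c_gt0 n)) uq k.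
  move=> /le_trans; apply; rewrite ler_wpM2l ?(ltW (cauchy_coef_gt0 k))//.
  by rewrite lerXn2r ?nnegrE ?sqrtr_ge0 ?(ltW t0).
rewrite (_ : (fun _ => _) = fun k => (a + a + k%:R) / k.+1%:R * t); last first.
  apply/funext => k.
  have -> : cauchy_coef c k.+1 = (a + a + k%:R) * cauchy_coef c k / k.+1%:R.
    by rewrite -(cauchy_coef_rec c_rec) mulrAC divff ?mul1r// pnatr_eq0.
  rewrite exprS; field.
  by rewrite nat1r pnatr_eq0/= expf_neq0 ?(gt_eqF t0)//= gt_eqF.
rewrite -[X in _ --> X]mul1r; apply: cvgMr_tmp; exact: cvg_shift_ratio.
Qed.

Let radius : exists2 K : R, 1 < K &
  [/\ cvgn (pseries r K), cvgn (pseries d K)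
    & cvgn (pseries (pseries_diffs d) K)].
Proof.
have r_ge0 : 0 <= rho := sqrtr_ge0 q.
pose t : R := (1 + rho) / 2.
have t0 : 0 < t by rewrite /t; lra.
have rt : rho <= t by have := rho_lt1; rewrite /t; lra.
have t1 : t < 1 by have := rho_lt1; rewrite /t; lra.
have dom := ratio_dominated_r rt t0.
(* From [0 < t < 1], this radius exceeds 1 while its product with [t] stays below 1. *)
exists (2 / (1 + t)); first by rewrite ltr_pdivlMr; lra.
have K0 : 0 < 2 / (1 + t) by rewrite divr_gt0//; lra.
have tK : t * (2 / (1 + t)) < 1 by rewrite mulrA ltr_pdivrMr; lra.
split; apply: (is_cvg_ratio_dominated _ K0 tK) => //.
  exact: ratio_dominated_diffs.
by do 2!apply: ratio_dominated_diffs.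
Qed.

(** Truncating the differential equation leaves an exact boundary remainder, made of terms at index
    [n] only. Each of them tends to 0 where the series converge. *)
Let partial_ode (t : R) n :
  D t * pseries d t n.+1 - a * (u - 2 * q * t) * pseries r t n.+1
  = t * (- u * (d n * t ^+ n) + 2 * a * q * (r n * t ^+ n)
         + q * (n%:R * r n * t ^+ n) + t * q * (d n * t ^+ n)).
Proof.
elim: n => [|n IH].
  rewrite /pseries /series /= !big_nat1 /d /pseries_diffs r0 r1 /D; ring.
have dS : d n.+1 = u * d n - n%:R * q * r n + a * u * r n.+1 - 2 * a * q * r n.
  rewrite /d /pseries_diffs r_rec; ring.
have psS f : pseries f t n.+2 = pseries f t n.+1 + f n.+1 * t ^+ n.+1.
  by rewrite /pseries /series /= big_nat_recr.
rewrite !psS.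
transitivity ((D t * pseries d t n.+1 - a * (u - 2 * q * t) * pseries r t n.+1)
  + (D t * d n.+1 - a * (u - 2 * q * t) * r n.+1) * t ^+ n.+1); first by ring.
rewrite IH !dS exprS /D /d /pseries_diffs; ring.
Qed.

Let ode (t : R) : cvgn (pseries r t) -> cvgn (pseries d t) ->
  D t * limn (pseries d t) = a * (u - 2 * q * t) * limn (pseries r t).
Proof.
move=> cr cd; apply/eqP; rewrite -subr_eq0; apply/eqP.
have rt0 := cvg_series_cvg_0 cr; have dt0 := cvg_series_cvg_0 cd.
(* Up to an index shift, this is [t] times the general term of the differentiated series. *)
have nrt0 : n%:R * r n * t ^+ n @[n --> \oo] --> (0 : R).
  have : t * (d n * t ^+ n) @[n --> \oo] --> t * 0 by exact: (cvgMl_tmp dt0).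
  rewrite mulr0 (_ : (fun _ => _) = fun n => n.+1%:R * r n.+1 * t ^+ n.+1).
    by rewrite (cvg_shiftS (fun n => n%:R * r n * t ^+ n)).
  by apply/funext => n; rewrite exprS /d /pseries_diffs; ring.
have lim0 : D t * pseries d t n.+1 - a * (u - 2 * q * t) * pseries r t n.+1
    @[n --> \oo] --> (0 : R).
  under eq_fun do rewrite partial_ode.
  have <- : t * (- u * 0 + 2 * a * q * 0 + q * 0 + t * q * 0) = 0 by ring.
  apply: cvgMl_tmp; apply: cvgD; last exact: (cvgMl_tmp dt0).
  apply: cvgD; last exact: (cvgMl_tmp nrt0).
  by apply: cvgD; [exact: (cvgMl_tmp dt0)|exact: (cvgMl_tmp rt0)].
apply: (cvg_unique _ _ lim0) => //=.
apply: cvgB; apply: cvgMl_tmp; [move: cd|move: cr]; by rewrite -cvg_shiftS.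
Qed.

(** Since [u <= 2 * rho], [D t] is at least [(1 - rho * t) ^+ 2], and [rho * t < 1]. *)
Let D_gt0 (t : R) : 0 <= t <= 1 -> 0 < D t.
Proof.
move=> /andP[t0 t1].
have rq : rho ^+ 2 = q by rewrite sqr_sqrtr.
have r_ge0 : 0 <= rho := sqrtr_ge0 q.
have rt : rho * t < 1 by rewrite (le_lt_trans _ rho_lt1)// ler_piMr.
have ur : u <= 2 * rho.
  rewrite (le_trans (ler_norm _))// -(ler_pXn2r (n := 2)) ?nnegrE ?mulr_ge0//.
  by rewrite real_normK ?num_real// exprMn rq -natrX.
have : u * t <= 2 * rho * t by rewrite ler_wpM2r.
have : 0 < (1 - rho * t) ^+ 2 by rewrite exprn_gt0// subr_gt0.
by rewrite /D -rq; nra.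
Qed.

Lemma gegenbauer_generating : series r @ \oo --> ((1 - u + q) `^ a)^-1.
Proof.
have [K K1 [cr cd cdd]] := radius.
have tK (t : R) : 0 <= t <= 1 -> `|t| < `|K|.
  move=> /andP[t0 t1].
  rewrite !ger0_norm//; last by rewrite ltW// (lt_trans _ K1).
  exact: le_lt_trans K1.
pose g (t : R) : R := limn (pseries r t).
pose h (t : R) : R := g t * D t `^ a.
have dh (t : R) : 0 <= t <= 1 -> is_derive t (1 : R) h 0.
  move=> t01.
  have dg : is_derive t (1 : R) g (limn (pseries d t)).
    by apply: pseries_snd_diffs cr cd cdd _; exact: tK.
  have dD : is_derive t (1 : R) D (- u + 2 * q * t).
    rewrite /D; apply: is_derive_eq; rewrite /GRing.scale /=; ring.
  have dP : is_derive t (1 : R) (fun t => D t `^ a)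
      (a * D t `^ (a - 1) * (- u + 2 * q * t)).
    exact: (is_derive1_comp (is_derive1_powR a (D_gt0 t01)) dD).
  apply: (is_derive_eq (is_deriveM dg dP)).
  have := ode (is_cvg_pseries_inside cr (tK _ t01))
    (is_cvg_pseries_inside cd (tK _ t01)).
  rewrite /GRing.scale /= -(mulr_powRB1 (ltW (D_gt0 t01)) a_gt0) -/(g t) => E.
  (* Once [D ^ a] is split as [D * D ^ (a - 1)], the derivative of [h] contains the differential
     equation as a factor. *)
  rewrite (_ : _ + _ = D t `^ (a - 1) *
    (D t * limn (pseries d t) - a * (u - 2 * q * t) * g t)); last by ring.
  by rewrite E subrr mulr0.
have h10 : h 1 = h 0.
  apply/eqP; rewrite -subr_eq0.
  have [x||x x01 ->] := @MVT_segment R h (fun=> 0) 0 1 ler01.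
  - by rewrite in_itv /= => /andP[x0 x1]; apply: dh; rewrite !ltW.
  - apply: derivable_within_continuous => x; rewrite in_itv /= => x01.
    by have [] := dh _ x01.
  - by rewrite mul0r.
have h0 : h 0 = 1.
  rewrite /h /D mulr0 subr0 expr0n mulr0 addr0 powR1 mulr1.
  (* The shift discards the empty partial sum; all others equal 1 at [t = 0]. *)
  apply/cvg_lim => //; rewrite -(cvg_shiftS (pseries r 0)).
  rewrite (_ : (fun _ => _) = cst 1); first exact: cvg_cst.
  apply/funext => n; rewrite /pseries /series /= big_nat_recl//.
  rewrite expr0 r0 mulr1 big1 ?addr0//.
  by move=> i _; rewrite expr0n mulr0.
have g1 : g 1 = ((1 - u + q) `^ a)^-1.
  have D1 : D 1 = 1 - u + q by rewrite /D; ring.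
  have N0 : (1 - u + q) `^ a != 0.
    by rewrite gt_eqF// powR_gt0// -D1 D_gt0// ler01 lexx.
  by rewrite -[LHS](mulfK N0) -{1}D1 -/(h 1) h10 h0 mul1r.
rewrite -g1 /g (_ : series r = pseries r 1).
  by apply: is_cvg_pseries_inside cr _; apply: tK; rewrite ler01 lexx.
by congr series; apply/funext => n /=; rewrite expr1n mulr1.
Qed.
End GeneratingFunction.

(** * Paravectors *)

Section ParavectorAlgebra.
Variables (R : realType) (m : nat) (x : 'rV[R]_m.+1).

(** Adding the double sum to its transpose gives anticommutators, which vanish off the diagonal; the
    factor 2 is then cancelled. *)
Lemma vecpart_sqr :
  vecpart x * vecpart x = (- \sum_(j < m) x ord0 (lift ord0 j) ^+ 2)%:A.
Proof.
pose v (j : 'I_m) := x ord0 (lift ord0 j); pose e := cl_gen R (m := m).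
have E1 : vecpart x * vecpart x = \sum_i \sum_j (v i * v j) *: (e i * e j).
  rewrite /vecpart mulr_suml; apply: eq_bigr => i _; rewrite mulr_sumr.
  by apply: eq_bigr => j _; rewrite -scalerAl -scalerAr scalerA.
have E2 : vecpart x * vecpart x = \sum_i \sum_j (v i * v j) *: (e j * e i).
  rewrite E1 exchange_big; apply: eq_bigr => i _; apply: eq_bigr => j _.
  by rewrite mulrC.
have two : (2 : R) != 0 by rewrite pnatr_eq0.
apply: (scalerI two); rewrite scalerA scaler_nat mulr2n {1}E1 E2 -big_split /=.
rewrite mulrN -mulNr mulr_sumr scaler_suml; apply: eq_bigr => i _.
rewrite -big_split /= (bigD1 i) //= -scalerDr cl_gen_rel eqxx scalerA.
rewrite big1 => [|j ji].
  by rewrite addr0 mulr1 mulrC expr2.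
by rewrite -scalerDr cl_gen_rel eq_sym (negPf ji) mulr0 scale0r scaler0.
Qed.

Lemma paravecD : paravec x + paraconj x = (2 * x ord0 ord0)%:A.
Proof.
by rewrite /paravec /paraconj addrACA subrr addr0 -scalerDl mulr_natl mulr2n.
Qed.

Lemma paravecM : paravec x * paraconj x = (\sum_i x ord0 i ^+ 2)%:A.
Proof.
rewrite /paravec /paraconj mulrDl 2!mulrBr vecpart_sqr !mulr_algl mulr_algr.
by rewrite scalerA addrA subrK -scalerBl opprK big_ord_recl expr2.
Qed.

End ParavectorAlgebra.

(** The homogenized Gegenbauer polynomial: for real [u] and [q > 0] it is q^(n/2) C_n^a(u / (2 sqrt
    q)). *)
Fixpoint gegenbauer (R : numFieldType) (a u q : R) (n : nat) : R :=
  if n is n1.+1 then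
    if n1 is n2.+1 then
      ((a + n1%:R) * u * gegenbauer a u q n1
       - (a + a + n2%:R) * q * gegenbauer a u q n2) / n%:R
    else a * u
  else 1.

Lemma gegenbauer_rec (R : numFieldType) (a u q : R) k :
  k.+2%:R * gegenbauer a u q k.+2 =
  (a + k.+1%:R) * u * gegenbauer a u q k.+1
  - (a + a + k%:R) * q * gegenbauer a u q k.
Proof. by rewrite [gegenbauer _ _ _ k.+2]/= mulrC divfK// pnatr_eq0. Qed.

(** * Expansion of the Riesz potential *)

Section Expansion.
Variables (R : realType) (m : nat) (x : 'rV[R]_m.+1).

(** For m > 1 the denominator [(m-1)_k] is positive and cancels, and the binomial over k! splits
    into 1 / ((k-s)! s!). *)
Lemma rieszP_cauchy k : (1 < m)%N ->
  (pochhammer (m%:R - 1) k / k`!%:R) *: rieszP k x =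
  cauchy_prod (fun n => pochhammer ((m%:R - 1) / 2) n / n`!%:R)
    (paravec x) (paraconj x) k.
Proof.
move=> m1; have b0 : 0 < m%:R - 1 :> R by rewrite subr_gt0 ltr1n.
rewrite /rieszP scaler_sumr; apply: eq_bigr => s _.
rewrite scalerA; congr (_ *: _).
have sk : (s <= k)%N by rewrite -ltnS.
have /(congr1 (fun n => n%:R : R)) := bin_fact sk.
rewrite !natrM => <-; field.
by rewrite !pnatr_eq0 -!lt0n !fact_gt0 bin_gt0 sk gt_eqF ?pochhammer_gt0.
Qed.

Lemma enorm_one_sub :
  enorm (one_pt - x) = Num.sqrt (1 - 2 * x ord0 ord0 + \sum_i x ord0 i ^+ 2).
Proof.
rewrite /enorm; congr Num.sqrt; rewrite !big_ord_recl !mxE eqxx /= addrA.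
congr (_ + _); first by ring.
by apply: eq_bigr => i _; rewrite !mxE /= sub0r sqrrN.
Qed.

End Expansion.

Theorem theorem6p5 (R : realType) (m : nat) (hm : (0 < m)%N)
    (x : 'rV[R]_m.+1) (hx : enorm x < 1) :
  series (fun k : nat => (pochhammer (m%:R - 1) k / k`!%:R) *: rieszP k x)
    @ \oo --> ((riesz_potential x)%:A : clifford R m).
Proof.
(* For m = 1 the potential is the constant 1, and [pochhammer 0 k = 0] for k > 0 leaves only the
   term k = 0. *)
have [m1|m_gt1] := leqP m 1.
  have {hm m1} E : m = 1%N by apply/eqP; rewrite eqn_leq m1.
  move: x hx; rewrite E => x _.
  rewrite /riesz_potential expr0 invr1 scale1r -cvg_shiftS.
  rewrite (_ : (fun _ => _) = cst 1); first exact: cvg_cst.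
  apply/funext => n; rewrite /series /= big_nat_recl// big1 ?addr0 => [|i _].
    rewrite /rieszP big_ord1 /= subrr mul0r /pochhammer !eqxx !expr0 /=.
    by rewrite bin0 fact0 !(divr1, mulr1, scale1r).
  by rewrite /pochhammer subrr eqxx mul0r scale0r.
pose a : R := (m%:R - 1) / 2.
pose u : R := 2 * x ord0 ord0; pose q : R := \sum_i x ord0 i ^+ 2.
pose c n : R := pochhammer a n / n`!%:R.
have a0 : 0 < a by rewrite divr_gt0// subr_gt0 ltr1n.
have c0 : c 0%N = 1 by rewrite /c pochhammer0 ?(ltW a0)// divr1.
have c_rec n : n.+1%:R * c n.+1 = (a + n%:R) * c n.
  rewrite /c pochhammerS// factS natrM; field.
  by rewrite nat1r !pnatr_eq0 -lt0n fact_gt0.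
have q0 : 0 <= q by apply: sumr_ge0 => i _; exact: sqr_ge0.
have uq : u ^+ 2 <= 4 * q.
  rewrite /u exprMn -natrX ler_pM2l// /q (bigD1 ord0)//= lerDl.
  by apply: sumr_ge0 => i _; exact: sqr_ge0.
have q1 : q < 1 by move: hx; rewrite /enorm -[X in _ < X]sqrtr1 ltr_sqrt.
have r_rec := gegenbauer_rec a u q.
have -> : (fun k => (pochhammer (m%:R - 1) k / k`!%:R) *: rieszP k x) =
    (fun k => (gegenbauer a u q k)%:A).
  apply/funext => k; rewrite rieszP_cauchy//.
  exact: (cauchy_prodE _ _ r_rec c0 c_rec (paravecD x) (paravecM x)).
have -> : series (fun k => (gegenbauer a u q k)%:A : clifford R m) =
    (fun n => (series (gegenbauer a u q) n)%:A).
  by apply/funext => n; rewrite /series /= scaler_suml.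
apply: cvgZr_tmp.
have -> : riesz_potential x = ((1 - u + q) `^ a)^-1.
  rewrite /riesz_potential enorm_one_sub -/u -/q /a mulrC powRrM powR12_sqrt.
    by rewrite -(natrB _ hm) powR_mulrn// sqrtr_ge0.
  (* [1 - u + q >= 0], needed for the square root, follows from [(2 - u)^2 >= 0] and
     [u^2 <= 4 q]. *)
  by have := sqr_ge0 (2 - u); rewrite sqrrB; move: uq; lra.
exact: gegenbauer_generating c0 c_rec a0 uq q1.
Qed.
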